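(* Let $J$ be a $\times d$-invariant set, $\delta$ its Hausdorff dimension and $\mu$ the normalized measure $\mathcal{H}^\delta|_J/\mathcal{H}^\delta(J)$. For $x\ne y$ let $f_{x,y}$ be the unique affine map with $f_{x,y}(x)=0$, $f_{x,y}(y)=1$. Then for $\mu\times\mu$-almost every $(x,y)\in J\times J$, \[ f_{x,y}(J)\cap\mathbb{Q}=\{0,1\}. \] In particular $f_{x,y}(J)\cap\mathbb{Q}$ is not dense in $f_{x,y}(J)$.
   Context: Fix an integer $d\ge2$ and $E\subseteq\{0,\dots,d-1\}$ with $1<\#E<d$. The associated $\times d$-invariant set is $J=\{x\in[0,1]: x=\sum_{i\ge1}a_id^{-i}\text{ for some digits }a_i\in E\}$; its Hausdorff dimension is $\delta=\log\#E/\log d$, and under $\mu$ the base-$d$ digits of a random point are i.i.d. uniform on $E$. *)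

(* Defs.v *)
From Stdlib Require Import Reals Lra List QArith Qreals.
Open Scope R_scope.

(* A digit sequence a : nat -> nat with digits in E (a 0 is the first digit a_1). *)
Definition digits_in (E : list nat) (a : nat -> nat) : Prop :=
  forall i, In (a i) E.

(* x = sum_{i>=1} a_i d^{-i}, with a_i = a (i-1). *)
Definition digit_value (d : nat) (a : nat -> nat) (x : R) : Prop :=
  infinite_sum (fun i => INR (a i) / INR d ^ (S i)) x.

Definition inJ (d : nat) (E : list nat) (x : R) : Prop :=
  exists a, digits_in E a /\ digit_value d a x.

Definition is_rational (r : R) : Prop := exists q : Q, r = Q2R q.

Definition faff (x y z : R) : R := (z - x) / (y - x).

Definition in_cyl (u : list nat) (a : nat -> nat) : Prop :=
  forall i, (i < length u)%nat -> a i = nth i u 0%nat.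

Definition word_in (E : list nat) (u : list nat) : Prop :=
  forall e, In e u -> In e E.

(* Mass of a cylinder pair [u] x [v] under mu x mu (i.i.d. uniform digits on E). *)
Definition cyl_mass (E : list nat) (c : list nat * list nat) : R :=
  (/ INR (length E)) ^ (length (fst c) + length (snd c)).

(* N is null for the product (mu x mu) of the i.i.d. uniform-on-E digit measures:
   covered by countably many cylinder pairs of arbitrarily small total mass. *)
Definition pair_null (E : list nat) (N : (nat -> nat) -> (nat -> nat) -> Prop) : Prop :=
  forall eps, 0 < eps ->
  exists c : nat -> list nat * list nat,
    (forall k, word_in E (fst (c k)) /\ word_in E (snd (c k))) /\
    (forall a b, digits_in E a -> digits_in E b -> N a b ->
       exists k, in_cyl (fst (c k)) a /\ in_cyl (snd (c k)) b) /\
    (forall n, sum_f_R0 (fun k => cyl_mass E (c k)) n <= eps).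

Definition good_pair (d : nat) (E : list nat) (x y : R) : Prop :=
  x <> y /\
  (forall r, ((exists z, inJ d E z /\ r = faff x y z) /\ is_rational r)
             <-> (r = 0 \/ r = 1)) /\
  ~ (forall w, inJ d E w -> forall eps, 0 < eps ->
       exists z, inJ d E z /\ is_rational (faff x y z) /\
                 Rabs (faff x y z - faff x y w) < eps).

(* Main.v *)
Require Import Defs.
From Stdlib Require Import Reals List QArith Qreals.
From Stdlib Require Import ZArith Lra Lia Cantor Classical IndefiniteDescription.
From Coquelicot Require Import Coquelicot.
Open Scope R_scope.

(** Write a rational [r <> 0, 1] as [p / q].  A point [z] of [J] with [f_(x,y)(z) = r]
    satisfies [A x + B y = C z] with [A = q - p], [B = p], [C = q] all nonzero; the diagonal
    [x = y] is contained in the case [r = -1], [z = x].  The set of pairs [(x, y)] with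
    [A x + B y] in [C J + Z] is invariant under the shift of both digit sequences, so it is
    null as soon as some cylinder pair misses it: almost every pair visits that cylinder.
    If every cylinder pair met it, [A J + B J] would lie in the closure of [C J + Z];
    iterating this inclusion [d - 1] times, the closure of [C^(d-1) J + Z] would contain a
    translate of a multiple of the [(d-1)]-fold sumset of [J], hence a segment, whereas [J]
    is nowhere dense because a digit is missing. *)

(** * Digit expansions *)

Definition drop_digits (k : nat) (a : nat -> nat) : nat -> nat := fun i => a (k + i)%nat.

Definition scons (e : nat) (a : nat -> nat) : nat -> nat :=
  fun i => match i with O => e | S j => a j end.

Definition prefix (n : nat) (a : nat -> nat) : list nat := map a (seq 0 n).

Lemma length_prefix (n : nat) (a : nat -> nat) : length (prefix n a) = n.
Proof. unfold prefix; now rewrite length_map, length_seq. Qed.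

Lemma word_in_prefix (E : list nat) (n : nat) (a : nat -> nat) :
  digits_in E a -> word_in E (prefix n a).
Proof.
  intros Ha e Hin; apply in_map_iff in Hin; destruct Hin as (i & <- & _); apply Ha.
Qed.

Lemma in_cyl_prefix (n : nat) (a b : nat -> nat) :
  in_cyl (prefix n a) b <-> forall i, (i < n)%nat -> b i = a i.
Proof.
  assert (Hnth : forall i, (i < n)%nat -> nth i (prefix n a) 0%nat = a i).
  { intros i Hi; rewrite (nth_indep _ 0%nat (a 0%nat)) by now rewrite length_prefix.
    unfold prefix; now rewrite map_nth, seq_nth. }
  unfold in_cyl; rewrite length_prefix.
  split; intros H i Hi; rewrite H, ?Hnth by exact Hi; reflexivity.
Qed.

Lemma digit_value_series (d : nat) (a : nat -> nat) (x : R) :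
  digit_value d a x <-> is_series (fun i => INR (a i) / INR d ^ S i) x.
Proof. split; intros H; apply is_series_Reals; exact H. Qed.

Lemma INR_base_ge_2 (d : nat) : (2 <= d)%nat -> 2 <= INR d.
Proof. intros H; apply le_INR in H; simpl in H; lra. Qed.

Lemma digit_value_unique (d : nat) (a : nat -> nat) (x y : R) :
  digit_value d a x -> digit_value d a y -> x = y.
Proof.
  rewrite !digit_value_series; intros Hx Hy.
  rewrite <- (is_series_unique _ _ Hx); exact (is_series_unique _ _ Hy).
Qed.

Lemma digit_value_ext (d : nat) (a b : nat -> nat) (x : R) :
  (forall i, a i = b i) -> digit_value d a x -> digit_value d b x.
Proof.
  rewrite !digit_value_series; intros H; apply is_series_ext.
  intros n; now rewrite H.
Qed.

(** A rescaled geometric series. It dominates every digit series, which gives both convergence and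
    the upper bound 1. *)
Lemma is_series_max_digit (d : nat) : (2 <= d)%nat ->
  is_series (fun i => (INR d - 1) / INR d ^ S i) 1.
Proof.
  intros Hd; apply INR_base_ge_2 in Hd.
  assert (Hq : Rabs (/ INR d) < 1).
  { rewrite Rabs_pos_eq by (left; apply Rinv_0_lt_compat; lra).
    rewrite <- Rinv_1; apply Rinv_lt_contravar; lra. }
  pose proof (is_series_scal ((INR d - 1) / INR d) _ _ (is_series_geom _ Hq)) as H.
  assert (E1 : (INR d - 1) / INR d * / (1 - / INR d) = 1) by (field; lra).
  rewrite <- E1; revert H; apply is_series_ext; intros n.
  unfold scal; simpl; unfold mult; simpl.
  rewrite pow_inv; field; repeat split; try apply pow_nonzero; lra.
Qed.

Lemma digit_term_bounds (d n i : nat) : (2 <= d)%nat -> (n < d)%nat ->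
  0 <= INR n / INR d ^ S i <= (INR d - 1) / INR d ^ S i.
Proof.
  intros Hd Hn; apply INR_base_ge_2 in Hd.
  assert (Hp : 0 < INR d ^ S i) by (apply pow_lt; lra).
  assert (Hn' : INR n <= INR d - 1).
  { apply le_INR in Hn; rewrite S_INR in Hn; lra. }
  pose proof (pos_INR n); apply Rinv_0_lt_compat in Hp.
  unfold Rdiv; split; nra.
Qed.

Lemma digit_value_exists (d : nat) (a : nat -> nat) : (2 <= d)%nat ->
  (forall i, (a i < d)%nat) -> exists x, digit_value d a x.
Proof.
  intros Hd Ha.
  assert (H : ex_series (fun i => INR (a i) / INR d ^ S i)).
  { apply (@ex_series_le R_AbsRing R_CompleteNormedModule _ (fun i => (INR d - 1) / INR d ^ S i)).
    - intros n; destruct (digit_term_bounds d (a n) n Hd (Ha n)).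
      change (norm ?x) with (Rabs x); rewrite Rabs_pos_eq; assumption.
    - exists 1; exact (is_series_max_digit d Hd). }
  exists (Series (fun i => INR (a i) / INR d ^ S i)).
  apply digit_value_series, Series_correct, H.
Qed.

Lemma digit_value_bounds (d : nat) (a : nat -> nat) (x : R) : (2 <= d)%nat ->
  (forall i, (a i < d)%nat) -> digit_value d a x -> 0 <= x <= 1.
Proof.
  intros Hd Ha Hx; apply digit_value_series in Hx.
  rewrite <- (is_series_unique _ _ Hx).
  pose proof (is_series_max_digit d Hd) as H1.
  split.
  - replace 0 with (Series (fun n => 0 * (INR (a n) / INR d ^ S n))).
    2: { rewrite Series_scal_l; ring. }
    apply Series_le; [|exists x; exact Hx].
    intros n; destruct (digit_term_bounds d (a n) n Hd (Ha n)); lra.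
  - rewrite <- (is_series_unique _ _ H1).
    apply Series_le; [|exists 1; exact H1].
    intros n; apply digit_term_bounds; auto.
Qed.

Lemma digit_value_drop1 (d : nat) (a : nat -> nat) (x : R) : (2 <= d)%nat ->
  digit_value d a x -> digit_value d (drop_digits 1 a) (INR d * x - INR (a 0%nat)).
Proof.
  intros Hd Hx; apply INR_base_ge_2 in Hd.
  apply digit_value_series; apply digit_value_series in Hx.
  pose proof (is_series_scal (INR d) _ _ Hx) as H.
  assert (H' : is_series (fun i => scal (INR d) (INR (a (S i)) / INR d ^ S (S i)))
                 (INR d * x - INR (a 0%nat))).
  { apply (is_series_incr_1 (fun i => scal (INR d) (INR (a i) / INR d ^ S i))).
    replace (plus _ _) with (scal (INR d) x); [exact H|].
    unfold scal, plus; simpl; unfold mult; simpl; field; lra. }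
  revert H'; apply is_series_ext; intros n.
  unfold scal; simpl; unfold mult, drop_digits; simpl; field; repeat split; try apply pow_nonzero; lra.
Qed.

Lemma digit_value_scons (d e : nat) (a : nat -> nat) (x : R) : (2 <= d)%nat ->
  digit_value d a x -> digit_value d (scons e a) ((INR e + x) / INR d).
Proof.
  intros Hd Hx; apply INR_base_ge_2 in Hd.
  apply digit_value_series; apply digit_value_series in Hx.
  apply is_series_decr_1.
  replace (plus _ _) with (scal (/ INR d) x).
  2: { unfold scal, plus, opp; simpl; unfold mult; simpl; field; lra. }
  pose proof (is_series_scal (/ INR d) _ _ Hx) as H.
  revert H; apply is_series_ext; intros n.
  unfold scal; simpl; unfold mult; simpl; field; repeat split; try apply pow_nonzero; lra.
Qed.

Lemma digit_value_plus (d : nat) (a b : nat -> nat) (x y : R) :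
  digit_value d a x -> digit_value d b y ->
  digit_value d (fun i => a i + b i)%nat (x + y).
Proof.
  rewrite !digit_value_series; intros Hx Hy.
  generalize (is_series_plus _ _ _ _ Hx Hy); apply is_series_ext; intros n.
  unfold plus; simpl; rewrite plus_INR; unfold Rdiv; ring.
Qed.

Lemma digit_value_mult (d k : nat) (a : nat -> nat) (x : R) :
  digit_value d a x -> digit_value d (fun i => k * a i)%nat (INR k * x).
Proof.
  rewrite !digit_value_series; intros Hx.
  generalize (is_series_scal (INR k) _ _ Hx); apply is_series_ext; intros n.
  unfold scal; simpl; unfold mult; simpl; rewrite mult_INR; unfold Rdiv; ring.
Qed.

(** The shift fixes a constant sequence, so its value is the fixed point of [x -> d x - e]. *)
Lemma digit_value_const (d e : nat) : (2 <= d)%nat -> (e < d)%nat ->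
  digit_value d (fun _ => e) (INR e / (INR d - 1)).
Proof.
  intros Hd He.
  destruct (digit_value_exists d (fun _ => e) Hd (fun _ => He)) as [x Hx].
  assert (Hs : digit_value d (fun _ => e) (INR d * x - INR e)).
  { exact (digit_value_drop1 d _ x Hd Hx). }
  pose proof (digit_value_unique _ _ _ _ Hx Hs) as H.
  apply INR_base_ge_2 in Hd.
  replace (INR e / (INR d - 1)) with x; [exact Hx|].
  apply Rmult_eq_reg_r with (INR d - 1); [|lra].
  unfold Rdiv; rewrite Rmult_assoc, Rinv_l; lra.
Qed.

(** The integer [X] depends only on the first [n] digits, so one [X] serves all sequences that share
    them; two such values then differ only in their tails. *)
Lemma digit_value_split (d : nat) (a : nat -> nat) (x : R) (n : nat) :
  (2 <= d)%nat -> digit_value d a x ->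
  exists (X : Z) (t : R), digit_value d (drop_digits n a) t /\
    x * INR d ^ n = IZR X + t /\
    (forall b y, digit_value d b y -> (forall i, (i < n)%nat -> b i = a i) ->
       exists s, digit_value d (drop_digits n b) s /\ y * INR d ^ n = IZR X + s).
Proof.
  intros Hd Hx; induction n as [|n IH].
  - exists 0%Z, x; split; [exact Hx|split; [simpl; ring|]].
    intros b y Hy _; exists y; split; [exact Hy|simpl; ring].
  - destruct IH as (X & t & Ht & HX & Hall).
    assert (Hstep : forall b s, digit_value d (drop_digits n b) s ->
      digit_value d (drop_digits (S n) b) (INR d * s - INR (b n))).
    { intros b s Hs; pose proof (digit_value_drop1 d _ _ Hd Hs) as H.
      change (drop_digits n b 0) with (b (n + 0)%nat) in H; rewrite Nat.add_0_r in H.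
      revert H; apply digit_value_ext; intros i; unfold drop_digits.
      f_equal; lia. }
    exists (Z.of_nat d * X + Z.of_nat (a n))%Z, (INR d * t - INR (a n)).
    rewrite plus_IZR, mult_IZR, <- !INR_IZR_INZ.
    split; [apply Hstep, Ht|split].
    + simpl; rewrite <- Rmult_assoc, (Rmult_comm x), Rmult_assoc, HX; ring.
    + intros b y Hy Hb.
      destruct (Hall b y Hy) as (s & Hs & E); [intros; apply Hb; lia|].
      exists (INR d * s - INR (b n)); split; [apply Hstep, Hs|].
      simpl; rewrite <- Rmult_assoc, (Rmult_comm y), Rmult_assoc, E, Hb by lia; ring.
Qed.

Lemma prefix_digit_value_close (d : nat) (a b : nat -> nat) (x y : R) (n : nat) :
  (2 <= d)%nat -> (forall i, (a i < d)%nat) -> (forall i, (b i < d)%nat) ->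
  digit_value d a x -> digit_value d b y ->
  (forall i, (i < n)%nat -> b i = a i) -> Rabs (x - y) <= (/ INR d) ^ n.
Proof.
  intros Hd Ha Hb Hx Hy E.
  destruct (digit_value_split d a x n Hd Hx) as (X & t & Ht & HX & Hall).
  destruct (Hall b y Hy E) as (s & Hs & HY).
  destruct (digit_value_bounds d _ t Hd (fun i => Ha (n + i)%nat) Ht).
  destruct (digit_value_bounds d _ s Hd (fun i => Hb (n + i)%nat) Hs).
  apply INR_base_ge_2 in Hd.
  assert (Hp : 0 < INR d ^ n) by (apply pow_lt; lra).
  replace (x - y) with ((t - s) * / INR d ^ n).
  2: { apply Rmult_eq_reg_r with (INR d ^ n); [|lra].
       rewrite Rmult_assoc, Rinv_l by lra; lra. }
  rewrite Rabs_mult, pow_inv, (Rabs_pos_eq (/ _)).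
  2: left; apply Rinv_0_lt_compat, Hp.
  rewrite <- Rmult_1_l; apply Rmult_le_compat_r.
  - left; apply Rinv_0_lt_compat, Hp.
  - apply Rabs_le; lra.
Qed.

(** Long division: the leading digit is a quotient and the remainder supplies the other digits.
    These fractions are dense in the unit interval and later stand in for all points of a
    segment. *)
Lemma digit_value_dary_rational (d n p : nat) : (2 <= d)%nat -> (p < d ^ n)%nat ->
  exists g, (forall i, (g i < d)%nat) /\ digit_value d g (INR p / INR d ^ n).
Proof.
  intros Hd; revert p; induction n as [|n IH]; intros p Hp; simpl in Hp.
  - exists (fun _ => 0%nat); split; [intros; lia|].
    replace p with 0%nat by lia.
    replace (INR 0 / INR d ^ 0) with (INR 0 / (INR d - 1)) by (simpl; unfold Rdiv; ring).
    apply digit_value_const; lia.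
  - assert (Hdn : (d ^ n <> 0)%nat) by (apply Nat.pow_nonzero; lia).
    destruct (IH (p mod d ^ n)%nat) as (g & Hg & Hv); [now apply Nat.mod_upper_bound|].
    exists (scons (p / d ^ n)%nat g); split.
    + intros [|i]; simpl; [|apply Hg].
      apply Nat.Div0.div_lt_upper_bound; lia.
    + assert (HR := INR_base_ge_2 d Hd).
      pose proof (digit_value_scons d (p / d ^ n)%nat g _ Hd Hv) as H.
      assert (Ep : INR p = INR d ^ n * INR (p / d ^ n) + INR (p mod d ^ n)).
      { rewrite <- pow_INR, <- mult_INR, <- plus_INR; f_equal; apply Nat.div_mod_eq. }
      replace (INR p / INR d ^ S n)
        with ((INR (p / d ^ n) + INR (p mod d ^ n) / INR d ^ n) / INR d); [exact H|].
      rewrite Ep; simpl; field; repeat split; try apply pow_nonzero; lra.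
Qed.

(** * [J] is nowhere dense *)

Lemma pow_inv_base_small (d : nat) (eps : R) : (2 <= d)%nat -> 0 < eps ->
  exists n, (/ INR d) ^ n < eps.
Proof.
  intros Hd He; apply INR_base_ge_2 in Hd.
  assert (H0 : 0 < / INR d) by (apply Rinv_0_lt_compat; lra).
  assert (Hq : Rabs (/ INR d) < 1).
  { rewrite Rabs_pos_eq by lra.
    rewrite <- Rinv_1; apply Rinv_lt_contravar; lra. }
  destruct (pow_lt_1_zero _ Hq eps He) as [n Hn]; exists n.
  specialize (Hn n (Nat.le_refl n)); rewrite Rabs_pos_eq in Hn; [exact Hn|].
  apply pow_le; lra.
Qed.

Lemma pow_base_large (d : nat) (K : R) : (2 <= d)%nat -> exists n, K < INR d ^ n.
Proof.
  intros Hd.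
  assert (HK : 0 < / (1 + Rabs K)) by (pose proof (Rabs_pos K); apply Rinv_0_lt_compat; lra).
  destruct (pow_inv_base_small d _ Hd HK) as [n Hn]; exists n.
  apply INR_base_ge_2 in Hd; rewrite pow_inv in Hn.
  assert (Hp : 0 < INR d ^ n) by (apply pow_lt; lra).
  pose proof (Rabs_pos K); pose proof (Rle_abs K).
  apply Rinv_lt_cancel in Hn; lra.
Qed.

Lemma missing_digit (d : nat) (E : list nat) : (length E < d)%nat ->
  exists f, (f < d)%nat /\ ~ In f E.
Proof.
  intros H; apply NNPP; intros Hno.
  assert (Hi : incl (seq 0 d) E).
  { intros f Hf; apply in_seq in Hf; apply NNPP; intros Hn.
    apply Hno; exists f; split; [lia|exact Hn]. }
  apply NoDup_incl_length in Hi; [|apply seq_NoDup].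
  rewrite length_seq in Hi; lia.
Qed.

(** The gap consists of the points with the missing digit [f] at place [n + 1], inside some interval
    [[P / d^n, (P + 1) / d^n]] contained in [[a, b]]. It is open because an endpoint may have a
    second expansion that avoids [f]. *)
Lemma J_gap (d : nat) (E : list nat) (a b : R) : (2 <= d)%nat ->
  (forall e, In e E -> (e < d)%nat) -> (length E < d)%nat -> a < b ->
  exists a' b', a <= a' < b' /\ b' <= b /\ forall z, a' < z < b' -> ~ inJ d E z.
Proof.
  intros Hd HE Hlen Hab.
  destruct (missing_digit d E Hlen) as (f & Hf & HfE).
  destruct (pow_base_large d (2 / (b - a)) Hd) as [n Hn].
  assert (HR := INR_base_ge_2 d Hd).
  set (N := INR d ^ n) in *.
  assert (HN : 0 < N) by (apply pow_lt; lra).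
  assert (HNab : 2 < N * (b - a)).
  { apply (Rmult_lt_compat_r (b - a)) in Hn; [|lra].
    unfold Rdiv in Hn; rewrite Rmult_assoc, Rinv_l in Hn; lra. }
  destruct (archimed (a * N)) as [Hup1 Hup2]; set (P := up (a * N)) in *.
  assert (HfR : 0 <= INR f <= INR d - 1).
  { split; [apply pos_INR|]. apply le_INR in Hf; rewrite S_INR in Hf; lra. }
  assert (HdN : 0 < INR d * N) by (apply Rmult_lt_0_compat; lra).
  exists ((IZR P * INR d + INR f) / (INR d * N)),
         ((IZR P * INR d + INR f + 1) / (INR d * N)).
  assert (HM : forall u v, u <= v -> u / (INR d * N) <= v / (INR d * N)).
  { intros u v Huv; apply Rmult_le_compat_r; [left; apply Rinv_0_lt_compat|]; lra. }
  repeat split.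
  - replace a with (a * N * INR d / (INR d * N)) by (field; lra).
    apply HM; nra.
  - apply Rmult_lt_compat_r; [apply Rinv_0_lt_compat|]; lra.
  - replace b with (b * N * INR d / (INR d * N)) by (field; lra).
    apply HM; nra.
  - intros z [Hz1 Hz2] (al & Hal & Hv).
    destruct (digit_value_split d al z n Hd Hv) as (Y & s & Hs & Hz & _).
    pose proof (digit_value_drop1 d _ _ Hd Hs) as Ht.
    change (drop_digits n al 0) with (al (n + 0)%nat) in Ht; rewrite Nat.add_0_r in Ht.
    apply digit_value_bounds in Ht; [|exact Hd|intros i; apply HE, Hal].
    fold N in Hz.
    apply (Rmult_lt_compat_r (INR d * N)) in Hz1, Hz2; try exact HdN.
    unfold Rdiv in Hz1, Hz2; rewrite Rmult_assoc, Rinv_l in Hz1, Hz2 by lra.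
    assert (Hz' : z * (INR d * N) = INR d * IZR Y + INR d * s).
    { rewrite <- Rmult_plus_distr_l, <- Hz; ring. }
    (* The point [z d N] lies strictly between [P d + f] and its successor, and also between
       [d Y + al n] and its successor; so the two integers differ by less than 1. *)
    assert (Heq : (Z.of_nat d * Y + Z.of_nat (al n) = P * Z.of_nat d + Z.of_nat f)%Z).
    { apply Z.le_antisymm; apply Z.lt_succ_r, lt_IZR; unfold Z.succ;
        rewrite !plus_IZR, !mult_IZR, <- !INR_IZR_INZ; lra. }
    apply HfE; replace f with (al n); [apply Hal|].
    assert (Han := HE _ (Hal n)).
    (* Two digits below [d] whose difference is a multiple of [d] are equal. *)
    assert (Hdiv : (Z.of_nat d * (P - Y) = Z.of_nat (al n) - Z.of_nat f)%Z) by lia.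
    assert (P - Y = 0)%Z by nia.
    nia.
Qed.

Lemma J_affine_gap (d : nat) (E : list nat) (u v a b : R) : (2 <= d)%nat ->
  (forall e, In e E -> (e < d)%nat) -> (length E < d)%nat -> u <> 0 -> a < b ->
  exists a' b', a <= a' < b' /\ b' <= b /\
    forall t, a' < t < b' -> ~ inJ d E (u * t + v).
Proof.
  intros Hd HE Hlen Hu Hab.
  destruct (Rdichotomy _ _ Hu) as [Hneg|Hpos].
  - destruct (J_gap d E (u * b + v) (u * a + v) Hd HE Hlen ltac:(nra))
      as (a' & b' & [H1 H2] & H3 & H4).
    assert (E1 : u * ((b' - v) / u) = b' - v) by (field; lra).
    assert (E2 : u * ((a' - v) / u) = a' - v) by (field; lra).
    exists ((b' - v) / u), ((a' - v) / u); repeat split; try nra.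
    intros t Ht; apply H4; nra.
  - destruct (J_gap d E (u * a + v) (u * b + v) Hd HE Hlen ltac:(nra))
      as (a' & b' & [H1 H2] & H3 & H4).
    assert (E1 : u * ((b' - v) / u) = b' - v) by (field; lra).
    assert (E2 : u * ((a' - v) / u) = a' - v) by (field; lra).
    exists ((a' - v) / u), ((b' - v) / u); repeat split; try nra.
    intros t Ht; apply H4; nra.
Qed.

(** Finitely many affine copies of [J] are avoided one after another, each inside the gap left by
    the previous ones. *)
Lemma J_translates_gap (d : nat) (E : list nat) (u : R) (v : nat -> R) (a b : R) (k : nat) :
  (2 <= d)%nat ->
  (forall e, In e E -> (e < d)%nat) -> (length E < d)%nat -> u <> 0 -> a < b ->
  exists a' b', a <= a' < b' /\ b' <= b /\
    forall t i, (i < k)%nat -> a' < t < b' -> ~ inJ d E (u * t + v i).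
Proof.
  intros Hd HE Hlen Hu Hab; induction k as [|k IH].
  - exists a, b; repeat split; try lra; intros; lia.
  - destruct IH as (a1 & b1 & [H1 H2] & H3 & H4).
    destruct (J_affine_gap d E u (v k) a1 b1 Hd HE Hlen Hu H2)
      as (a2 & b2 & [G1 G2] & G3 & G4).
    exists a2, b2; repeat split; try lra.
    intros t i Hi Ht.
    destruct (Nat.eq_dec i k) as [->|Hne]; [now apply G4|].
    apply H4; [lia|lra].
Qed.

Lemma dary_dense (d : nat) (a b : R) : (2 <= d)%nat -> 0 <= a < b -> b <= 1 ->
  exists n p, (p < d ^ n)%nat /\ a < INR p / INR d ^ n < b.
Proof.
  intros Hd Ha Hb.
  destruct (pow_base_large d (2 / (b - a)) Hd) as [n Hn].
  assert (HR := INR_base_ge_2 d Hd).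
  assert (HN : 0 < INR d ^ n) by (apply pow_lt; lra).
  assert (HNab : 2 < INR d ^ n * (b - a)).
  { apply (Rmult_lt_compat_r (b - a)) in Hn; [|lra].
    unfold Rdiv in Hn; rewrite Rmult_assoc, Rinv_l in Hn; lra. }
  destruct (archimed (a * INR d ^ n)) as [Hup1 Hup2].
  assert (Hpos : (0 <= up (a * INR d ^ n))%Z) by (apply le_IZR; nra).
  exists n, (Z.to_nat (up (a * INR d ^ n))).
  rewrite (INR_IZR_INZ (Z.to_nat _)), Z2Nat.id by exact Hpos.
  split; [|split].
  - apply INR_lt; rewrite INR_IZR_INZ, Z2Nat.id, pow_INR by exact Hpos; nra.
  - apply Rmult_lt_reg_r with (INR d ^ n); [exact HN|].
    unfold Rdiv; rewrite Rmult_assoc, Rinv_l; lra.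
  - apply Rmult_lt_reg_r with (INR d ^ n); [exact HN|].
    unfold Rdiv; rewrite Rmult_assoc, Rinv_l; nra.
Qed.

(* [v] lies in the closure of [M J + Z]. *)
Definition adherent (d : nat) (E : list nat) (M v : R) : Prop :=
  forall eps, 0 < eps ->
  exists z n, inJ d E z /\ Rabs (v - M * z - IZR n) < eps.

(** A bounded segment comes near only finitely many integer translates of [M J]. Read in the
    parameter [t], these are affine copies of [J], and they leave a common gap that contains some
    [p / d^n]. *)
Lemma adherent_no_segment (d : nat) (E : list nat) (M l c : R) : (2 <= d)%nat ->
  (forall e, In e E -> (e < d)%nat) -> (length E < d)%nat -> M <> 0 -> l <> 0 ->
  ~ (forall n p, (p < d ^ n)%nat -> adherent d E M (l * (INR p / INR d ^ n) + c)).
Proof.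
  intros Hd HE Hlen HM Hl H.
  set (K := up (Rabs l + Rabs c + Rabs M + 1)).
  assert (HK : Rabs l + Rabs c + Rabs M + 1 < IZR K) by apply archimed.
  assert (Pl := Rabs_pos l); assert (Pc := Rabs_pos c); assert (PM := Rabs_pos M).
  assert (HK0 : (0 < K)%Z) by (apply lt_IZR; lra).
  assert (Hu : l / M <> 0).
  { unfold Rdiv; apply Rmult_integral_contrapositive_currified; [exact Hl|].
    apply Rinv_neq_0_compat, HM. }
  (* Index [i] stands for the integer [i - K], so [2 K] indices cover all [m] with [-K <= m < K]. *)
  destruct (J_translates_gap d E (l / M)
              (fun i => (c - IZR (Z.of_nat i - K)) / M) 0 1 (Z.to_nat (2 * K)) Hd HE Hlen Hu)
    as (a & b & [Ha Hab] & Hb & Hgap); [lra|].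
  destruct (dary_dense d a b Hd ltac:(lra) Hb) as (n & p & Hp & Ht).
  set (t := INR p / INR d ^ n) in *.
  assert (Al : 0 < Rabs l) by (apply Rabs_pos_lt, Hl).
  set (del := Rmin (t - a) (b - t)).
  assert (Hdel : 0 < del) by (apply Rmin_pos; lra).
  (* An error below 1 keeps [m] among the listed translates; an error below [Rabs l * del] keeps the
     corrected parameter in the gap. *)
  destruct (H n p Hp (Rmin 1 (Rabs l * del))) as (z & m & Hz & Hm).
  { apply Rmin_pos; [lra|apply Rmult_lt_0_compat; lra]. }
  fold t in Hm.
  assert (Hz01 : 0 <= z <= 1).
  { destruct Hz as (al & Hal & Hv); apply (digit_value_bounds d al); auto. }
  assert (Hm1 := Rlt_le_trans _ _ _ Hm (Rmin_l _ _)).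
  assert (Hm2 := Rlt_le_trans _ _ _ Hm (Rmin_r _ _)).
  assert (Hmb : Rabs (IZR m) < IZR K).
  { replace (IZR m) with (- (l * t + c - M * z - IZR m) + l * t + c + - (M * z)) by ring.
    eapply Rle_lt_trans; [apply Rabs_triang|].
    eapply Rle_lt_trans; [apply Rplus_le_compat_r, Rabs_triang|].
    eapply Rle_lt_trans; [apply Rplus_le_compat_r, Rplus_le_compat_r, Rabs_triang|].
    rewrite !Rabs_Ropp, !Rabs_mult, (Rabs_pos_eq t), (Rabs_pos_eq z) by lra.
    nra. }
  apply Rabs_def2 in Hmb; destruct Hmb as [Hmb1 Hmb2].
  rewrite <- opp_IZR in Hmb2; apply lt_IZR in Hmb1, Hmb2.
  (* Moving [t] by [w] makes the approximation exact: [l (t - w) + c = M z + m]. *)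
  set (w := (l * t + c - M * z - IZR m) / l).
  assert (Hw : Rabs w < del).
  { unfold w, Rdiv; rewrite Rabs_mult, Rabs_inv.
    apply Rmult_lt_reg_r with (Rabs l); [exact Al|].
    rewrite Rmult_assoc, Rinv_l; lra. }
  apply Rabs_def2 in Hw.
  assert (D1 := Rmin_l (t - a) (b - t)); assert (D2 := Rmin_r (t - a) (b - t)).
  fold del in D1, D2.
  apply (Hgap (t - w) (Z.to_nat (m + K))); [lia|lra|].
  rewrite Z2Nat.id by lia.
  replace (m + K - K)%Z with m by lia.
  replace (l / M * (t - w) + (c - IZR m) / M) with z; [exact Hz|].
  unfold w; field; split; assumption.
Qed.

(** * Some point of [A J + B J] avoids [C J + Z] *)

(** Approximate [v] by [M z + n] and [v'] by [M z' + n'], then [A z + B z'] by [C w + m]. Since [M],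
    [A] and [B] are integers, the remainders add up to an integer. *)
Lemma adherent_combine (d : nat) (E : list nat) (A B C : Z) (M : Z) (v v' : R) :
  (forall x y, inJ d E x -> inJ d E y -> adherent d E (IZR C) (IZR A * x + IZR B * y)) ->
  adherent d E (IZR M) v -> adherent d E (IZR M) v' ->
  adherent d E (IZR (M * C)) (IZR A * v + IZR B * v').
Proof.
  intros H Hv Hv' eps He.
  (* The three errors enter with coefficients [A], [B] and [M]; the extra 1 keeps [T] positive. *)
  set (T := Rabs (IZR A) + Rabs (IZR B) + Rabs (IZR M) + 1).
  assert (PA := Rabs_pos (IZR A)); assert (PB := Rabs_pos (IZR B));
    assert (PM := Rabs_pos (IZR M)).
  assert (HT : 0 < T) by (unfold T; lra).
  assert (Hd : 0 < eps / T) by (apply Rdiv_lt_0_compat; lra).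
  assert (ET : eps / T * T = eps) by (field; lra).
  set (h := eps / T) in *; unfold T in ET; clearbody h; clear T HT.
  destruct (Hv h Hd) as (z & n & Hz & Hn).
  destruct (Hv' h Hd) as (z' & n' & Hz' & Hn').
  destruct (H z z' Hz Hz' h Hd) as (w & m & Hw & Hm).
  exists w, (M * m + A * n + B * n')%Z; split; [exact Hw|].
  rewrite !plus_IZR, !mult_IZR.
  replace (IZR A * v + IZR B * v' - IZR M * IZR C * w
           - (IZR M * IZR m + IZR A * IZR n + IZR B * IZR n'))
    with (IZR A * (v - IZR M * z - IZR n) + IZR B * (v' - IZR M * z' - IZR n')
          + IZR M * (IZR A * z + IZR B * z' - IZR C * w - IZR m)) by ring.
  eapply Rle_lt_trans; [apply Rabs_triang|].
  eapply Rle_lt_trans; [apply Rplus_le_compat_r, Rabs_triang|].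
  rewrite !Rabs_mult; nra.
Qed.

(** At each place [h] chooses between [e0] and [e1]. Adding [d - 1] sequences of zeros and ones
    produces every base-[d] digit sequence, hence the interest of this affine copy inside [J]. *)
Lemma inJ_two_digits (d : nat) (E : list nat) (e0 e1 : nat) (h : nat -> nat) (t : R) :
  (2 <= d)%nat -> (forall e, In e E -> (e < d)%nat) ->
  In e0 E -> In e1 E -> (e0 < e1)%nat -> (forall i, (h i <= 1)%nat) ->
  digit_value d h t ->
  inJ d E (INR e0 / (INR d - 1) + INR (e1 - e0) * t).
Proof.
  intros Hd HE H0 H1 Hlt Hh Ht.
  exists (fun i => e0 + (e1 - e0) * h i)%nat; split.
  - intros i; specialize (Hh i).
    destruct (h i) as [|[|k]]; [| |lia].
    + replace (e0 + (e1 - e0) * 0)%nat with e0 by lia; exact H0.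
    + replace (e0 + (e1 - e0) * 1)%nat with e1 by lia; exact H1.
  - apply digit_value_plus; [apply digit_value_const; auto|].
    apply digit_value_mult, Ht.
Qed.

(* If [A J + B J] were in the closure of [C J + Z], iterating [k] times would put
   [A^k x + A^(k-1) B (y_1 + ... + y_k) + c] in the closure of [C^k J + Z].
   Letting each [y_j] use only the digits [e0 < e1], the digits of
   [y_1 + ... + y_k] take every value [k e0 + (e1 - e0) g] with [g <= k]. *)
Lemma adherent_iterate (d : nat) (E : list nat) (A B C : Z) (e0 e1 : nat) (k : nat) :
  (2 <= d)%nat -> (forall e, In e E -> (e < d)%nat) ->
  In e0 E -> In e1 E -> (e0 < e1)%nat -> A <> 0%Z -> (k < d)%nat ->
  (forall x y, inJ d E x -> inJ d E y -> adherent d E (IZR C) (IZR A * x + IZR B * y)) ->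
  exists c, forall x g t, inJ d E x -> (forall i, (g i <= k)%nat) -> digit_value d g t ->
    adherent d E (IZR (C ^ Z.of_nat k))
      (IZR A ^ k * x + IZR A ^ k / IZR A * IZR B * INR (e1 - e0) * t + c).
Proof.
  intros Hd HE H0 H1 Hlt HA Hk H.
  apply eq_IZR_contrapositive in HA.
  assert (Hzero : digit_value d (fun _ => 0%nat) 0).
  { replace 0 with (INR 0 / (INR d - 1)) by (simpl; unfold Rdiv; ring).
    apply digit_value_const; lia. }
  induction k as [|k IH].
  - exists 0; intros x g t Hx Hg Ht eps He; exists x, 0%Z; split; [exact Hx|].
    (* For [k = 0] the sequence [g] vanishes, so the term with coefficient [A^0 / A] disappears. *)
    assert (t = 0) as ->.
    { apply (digit_value_unique d g); [exact Ht|].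
      revert Hzero; apply digit_value_ext; intros i; specialize (Hg i); lia. }
    simpl; match goal with |- Rabs ?u < _ => replace u with 0 by ring end.
    rewrite Rabs_R0; exact He.
  - destruct IH as (c & IH); [lia|].
    (* The induction hypothesis is used at [x] with the part [g1] of [g], and at a two-digit point
       [y] with the zero sequence. The constant collects both offsets and the [e0] part of [y]. *)
    exists (IZR A * c + IZR B * (IZR A ^ k * (INR e0 / (INR d - 1)) + c)).
    intros x g t Hx Hg Ht.
    (* This splits [g] as [g1 + h] with [g1 <= k] and [h <= 1]. *)
    set (g1 := fun i => Nat.min (g i) k); set (h := fun i => (g i - k)%nat).
    destruct (digit_value_exists d g1 Hd) as [t1 Ht1]; [intros i; unfold g1; lia|].
    destruct (digit_value_exists d h Hd) as [s Hs].
    { intros i; unfold h; specialize (Hg i); lia. }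
    assert (Et : t = t1 + s).
    { apply (digit_value_unique d g); [exact Ht|].
      generalize (digit_value_plus d g1 h t1 s Ht1 Hs); apply digit_value_ext.
      intros i; unfold g1, h; lia. }
    assert (Hy := inJ_two_digits d E e0 e1 h s Hd HE H0 H1 Hlt
                    ltac:(intros i; unfold h; specialize (Hg i); lia) Hs).
    pose proof (adherent_combine d E A B C _ _ _ H
      (IH x g1 t1 Hx ltac:(intros i; unfold g1; lia) Ht1)
      (IH _ (fun _ => 0%nat) 0 Hy (fun _ => Nat.le_0_l k) Hzero)) as G.
    replace (C ^ Z.of_nat (S k))%Z with (C ^ Z.of_nat k * C)%Z.
    2: { rewrite Nat2Z.inj_succ, Z.pow_succ_r; [ring|apply Nat2Z.is_nonneg]. }
    match goal with G : adherent _ _ _ ?a |- adherent _ _ _ ?b =>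
      replace b with a; [exact G|] end.
    rewrite Et; simpl; field.
    apply INR_base_ge_2 in Hd; split; lra.
Qed.

(** After [d - 1] iterations [g] may be any digit sequence. With [x] fixed at a constant expansion,
    [t] runs through all [p / d^n], which [adherent_no_segment] forbids. *)
Lemma not_all_adherent (d : nat) (E : list nat) (A B C : Z) (e0 e1 : nat) :
  (2 <= d)%nat -> (forall e, In e E -> (e < d)%nat) -> (length E < d)%nat ->
  In e0 E -> In e1 E -> (e0 < e1)%nat -> A <> 0%Z -> B <> 0%Z -> C <> 0%Z ->
  ~ (forall x y, inJ d E x -> inJ d E y ->
       adherent d E (IZR C) (IZR A * x + IZR B * y)).
Proof.
  intros Hd HE Hlen H0 H1 Hlt HA HB HC H.
  destruct (adherent_iterate d E A B C e0 e1 (d - 1) Hd HE H0 H1 Hlt HA ltac:(lia) H)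
    as (c & Hc).
  assert (Hx : inJ d E (INR e0 / (INR d - 1))).
  { exists (fun _ => e0); split; [intros i; exact H0|]. apply digit_value_const; auto. }
  assert (HA' : IZR A <> 0) by now apply eq_IZR_contrapositive.
  assert (HB' : IZR B <> 0) by now apply eq_IZR_contrapositive.
  assert (He : INR (e1 - e0) <> 0) by (apply not_0_INR; lia).
  set (l := IZR A ^ (d - 1) / IZR A * IZR B * INR (e1 - e0)).
  set (c' := IZR A ^ (d - 1) * (INR e0 / (INR d - 1)) + c).
  apply (adherent_no_segment d E (IZR (C ^ Z.of_nat (d - 1))) l c' Hd HE Hlen).
  - apply eq_IZR_contrapositive, Z.pow_nonzero; [exact HC|lia].
  - unfold l, Rdiv; repeat apply Rmult_integral_contrapositive_currified; try assumption.
    + apply pow_nonzero, HA'.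
    + apply Rinv_neq_0_compat, HA'.
  - intros n p Hp.
    destruct (digit_value_dary_rational d n p Hd Hp) as (g & Hg & Hv).
    specialize (Hc _ g _ Hx ltac:(intros i; specialize (Hg i); lia) Hv).
    fold l in Hc.
    replace (l * (INR p / INR d ^ n) + c')
      with (IZR A ^ (d - 1) * (INR e0 / (INR d - 1)) + l * (INR p / INR d ^ n) + c)
      by (unfold c'; ring).
    exact Hc.
Qed.

(** For [A = q - p], [B = p], [C = q], [n = 0] and [x <> y] the equation says that [faff x y z] is
    [p / q]. The integer [n] is there to make the relation shift invariant. *)
Definition related (d : nat) (E : list nat) (A B C : Z) (a b : nat -> nat) : Prop :=
  exists x y z n, digit_value d a x /\ digit_value d b y /\ inJ d E z /\
    IZR A * x + IZR B * y = IZR C * z + IZR n.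

(** Multiply the equation by [d]; the leading digits of [x], [y] and [z] are absorbed into [n]. *)
Lemma related_drop1 (d : nat) (E : list nat) (A B C : Z) (a b : nat -> nat) :
  (2 <= d)%nat -> related d E A B C a b ->
  related d E A B C (drop_digits 1 a) (drop_digits 1 b).
Proof.
  intros Hd (x & y & z & n & Hx & Hy & (al & Hal & Hz) & Eq).
  exists (INR d * x - INR (a 0%nat)), (INR d * y - INR (b 0%nat)),
    (INR d * z - INR (al 0%nat)),
    (Z.of_nat d * n + C * Z.of_nat (al 0%nat) - A * Z.of_nat (a 0%nat)
       - B * Z.of_nat (b 0%nat))%Z.
  repeat split; try now apply digit_value_drop1.
  - exists (drop_digits 1 al); split; [intros i; apply Hal|now apply digit_value_drop1].
  - rewrite !minus_IZR, !plus_IZR, !mult_IZR, <- !INR_IZR_INZ.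
    replace (IZR n) with (IZR A * x + IZR B * y - IZR C * z) by lra; ring.
Qed.

Lemma related_ext (d : nat) (E : list nat) (A B C : Z) (a b a' b' : nat -> nat) :
  (forall i, a i = a' i) -> (forall i, b i = b' i) ->
  related d E A B C a b -> related d E A B C a' b'.
Proof.
  intros Ha Hb (x & y & z & n & Hx & Hy & H); exists x, y, z, n.
  split; [now apply (digit_value_ext d a)|split; [now apply (digit_value_ext d b)|exact H]].
Qed.

Lemma related_drop (d : nat) (E : list nat) (A B C : Z) (a b : nat -> nat) (k : nat) :
  (2 <= d)%nat -> related d E A B C a b ->
  related d E A B C (drop_digits k a) (drop_digits k b).
Proof.
  intros Hd H; induction k as [|k IH]; [exact H|].
  apply related_drop1 in IH; [|exact Hd].
  revert IH; apply related_ext; intros i; unfold drop_digits; f_equal; lia.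
Qed.

(** If every pair of cylinders of equal depth held a related pair, deep cylinders around any
    [(x, y)] would make [A x + B y] adherent. Equal lengths allow both sequences to be cut into the
    same blocks later. *)
Lemma exists_unrelated_cylinder (d : nat) (E : list nat) (A B C : Z) (e0 e1 : nat) :
  (2 <= d)%nat -> (forall e, In e E -> (e < d)%nat) -> (length E < d)%nat ->
  In e0 E -> In e1 E -> (e0 < e1)%nat -> A <> 0%Z -> B <> 0%Z -> C <> 0%Z ->
  exists u v, length u = length v /\ word_in E u /\ word_in E v /\
    forall a b, digits_in E a -> digits_in E b -> in_cyl u a -> in_cyl v b ->
      ~ related d E A B C a b.
Proof.
  intros Hd HE Hlen H0 H1 Hlt HA HB HC; apply NNPP; intros Hno.
  apply (not_all_adherent d E A B C e0 e1 Hd HE Hlen H0 H1 Hlt HA HB HC).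
  intros x y (a & Ha & Hx) (b & Hb & Hy) eps He.
  assert (PA := Rabs_pos (IZR A)); assert (PB := Rabs_pos (IZR B)).
  set (T := Rabs (IZR A) + Rabs (IZR B) + 1).
  assert (HT : 0 < T) by (unfold T; lra).
  assert (Hh : 0 < eps / T) by (apply Rdiv_lt_0_compat; lra).
  assert (ET : eps / T * T = eps) by (field; lra).
  unfold T in ET at 2.
  destruct (pow_inv_base_small d _ Hd Hh) as [n Hn].
  apply NNPP; intros Hfar; apply Hno.
  exists (prefix n a), (prefix n b).
  rewrite !length_prefix; repeat split; try now apply word_in_prefix.
  intros a' b' Ha' Hb' Ca Cb (x' & y' & z & m & Hx' & Hy' & Hz & Eq).
  apply Hfar; exists z, m; split; [exact Hz|].
  assert (Dx := prefix_digit_value_close d a a' x x' n Hd (fun i => HE _ (Ha i))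
                  (fun i => HE _ (Ha' i)) Hx Hx' (proj1 (in_cyl_prefix n a a') Ca)).
  assert (Dy := prefix_digit_value_close d b b' y y' n Hd (fun i => HE _ (Hb i))
                  (fun i => HE _ (Hb' i)) Hy Hy' (proj1 (in_cyl_prefix n b b') Cb)).
  replace (IZR A * x + IZR B * y - IZR C * z - IZR m)
    with (IZR A * (x - x') + IZR B * (y - y')) by lra.
  eapply Rle_lt_trans; [apply Rabs_triang|].
  rewrite !Rabs_mult; nra.
Qed.

(** * Null sets of digit sequences *)

Definition total_mass (E : list nat) (l : list (list nat * list nat)) : R :=
  fold_right (fun c s => cyl_mass E c + s) 0 l.

Definition in_cyl_pair (c : list nat * list nat) (a b : nat -> nat) : Prop :=
  in_cyl (fst c) a /\ in_cyl (snd c) b.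

(** Each single fraction admits finite covers, whose masses are finite sums; infinite covers arise
    only in the union over all fractions. *)
Definition finite_cover_null (E : list nat) (N : (nat -> nat) -> (nat -> nat) -> Prop) :=
  forall eps, 0 < eps -> exists l,
    (forall c, In c l -> word_in E (fst c) /\ word_in E (snd c)) /\
    (forall a b, digits_in E a -> digits_in E b -> N a b ->
       exists c, In c l /\ in_cyl_pair c a b) /\
    total_mass E l <= eps.

Lemma total_mass_app (E : list nat) l l' :
  total_mass E (l ++ l') = total_mass E l + total_mass E l'.
Proof. induction l as [|c l IH]; simpl; [ring|rewrite IH; ring]. Qed.

Lemma cyl_mass_pos (E : list nat) c : (0 < length E)%nat -> 0 < cyl_mass E c.
Proof. intros H; apply pow_lt, Rinv_0_lt_compat, lt_0_INR, H. Qed.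

Lemma total_mass_ge_0 (E : list nat) l : (0 < length E)%nat -> 0 <= total_mass E l.
Proof.
  intros H; induction l as [|c l IH]; simpl; [lra|].
  pose proof (cyl_mass_pos E c H); lra.
Qed.

Lemma total_mass_uniform (E : list nat) l m :
  (forall c, In c l -> cyl_mass E c = m) -> total_mass E l = INR (length l) * m.
Proof.
  induction l as [|c l IH]; intros H; [simpl; ring|].
  change (length (c :: l)) with (S (length l)); rewrite S_INR; cbn [total_mass fold_right].
  rewrite (H c (or_introl eq_refl)).
  unfold total_mass in IH; rewrite IH; [ring|].
  intros c' Hc'; apply H; right; exact Hc'.
Qed.

Lemma sum_mass_nth_le (E : list nat) l c0 n : (0 < length E)%nat -> (n < length l)%nat ->
  sum_f_R0 (fun k => cyl_mass E (nth k l c0)) n <= total_mass E l.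
Proof.
  intros HE; revert n; induction l as [|c l IH]; intros n Hn; simpl in Hn; [lia|].
  destruct n as [|n].
  - simpl; pose proof (total_mass_ge_0 E l HE); lra.
  - rewrite decomp_sum by lia; simpl; apply Rplus_le_compat_l, IH; lia.
Qed.

(** A cover is padded with one cylinder of mass below [eps / 2]. Nonempty lists make every index
    valid when covers are concatenated into a sequence. *)
Lemma finite_cover_nonempty (E : list nat) N eps : (1 < length E)%nat ->
  finite_cover_null E N -> 0 < eps -> exists l, l <> nil /\
    (forall c, In c l -> word_in E (fst c) /\ word_in E (snd c)) /\
    (forall a b, digits_in E a -> digits_in E b -> N a b ->
       exists c, In c l /\ in_cyl_pair c a b) /\
    total_mass E l <= eps.
Proof.
  intros HE HN He.
  destruct (HN (eps / 2)) as (l & Hl & Hc & Hm); [lra|].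
  destruct (pow_inv_base_small (length E) (eps / 2)) as [n Hn]; [lia|lra|].
  destruct E as [|e E]; [simpl in HE; lia|].
  exists ((repeat e n, nil) :: l); repeat split.
  - discriminate.
  - destruct H as [<-|H]; [|now apply Hl].
    intros f Hf; apply repeat_spec in Hf; left; auto.
  - destruct H as [<-|H]; [|now apply Hl].
    intros f [].
  - intros a b Ha Hb Nab; destruct (Hc a b Ha Hb Nab) as (c & Hin & Hcc).
    exists c; split; [right|]; assumption.
  - change (cyl_mass (e :: E) (repeat e n, nil) + total_mass (e :: E) l <= eps).
    unfold cyl_mass; cbn [fst snd]; rewrite repeat_length, Nat.add_0_r; lra.
Qed.

Lemma pair_null_countable_union (E : list nat) (Ns : nat -> (nat -> nat) -> (nat -> nat) -> Prop)
    (N : (nat -> nat) -> (nat -> nat) -> Prop) : (1 < length E)%nat ->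
  (forall i, finite_cover_null E (Ns i)) ->
  (forall a b, digits_in E a -> digits_in E b -> N a b -> exists i, Ns i a b) ->
  pair_null E N.
Proof.
  intros HE Hnull Hcov eps He.
  destruct (functional_choice (fun i l => l <> nil /\
    (forall c, In c l -> word_in E (fst c) /\ word_in E (snd c)) /\
    (forall a b, digits_in E a -> digits_in E b -> Ns i a b ->
       exists c, In c l /\ in_cyl_pair c a b) /\
    total_mass E l <= eps * (/ 2) ^ S i)) as [l Hl].
  { intros i; apply finite_cover_nonempty; auto.
    apply Rmult_lt_0_compat; [exact He|apply pow_lt; lra]. }
  (* The covers [l 0, ..., l n] in a row; as none is empty, position [n] exists in [W n]. *)
  set (W := fix W n := match n with O => l O | S n => W n ++ l (S n) end).
  assert (Hlen : forall n, (n < length (W n))%nat).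
  { assert (Hp : forall i, (0 < length (l i))%nat).
    { intros i; destruct (Hl i) as [H _]; destruct (l i); [easy|simpl; lia]. }
    induction n as [|n IH]; simpl; [apply Hp|].
    rewrite length_app; specialize (Hp (S n)); lia. }
  assert (Hin : forall n c, In c (W n) -> exists i, In c (l i)).
  { induction n as [|n IH]; simpl; intros c Hc; [eauto|].
    apply in_app_iff in Hc; destruct Hc; eauto. }
  assert (Hmono : forall c0 k j n, (k <= n)%nat -> (j < length (W k))%nat ->
            nth j (W n) c0 = nth j (W k) c0 /\ (j < length (W n))%nat).
  { intros c0 k j n Hkn Hj; induction Hkn as [|n Hkn [IH1 IH2]]; [auto|].
    simpl; rewrite length_app, app_nth1 by exact IH2; split; [exact IH1|lia]. }
  (* By [Hmono] every later [W n] has the same entry at position [k], and the default [(nil, nil)],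
     of mass 1, is never read. *)
  exists (fun k => nth k (W k) (nil, nil)); split; [|split].
  - intros k; destruct (Hin k (nth k (W k) (nil, nil))) as [i Hi].
    { apply nth_In, Hlen. }
    destruct (Hl i) as (_ & H & _); now apply H.
  - intros a b Ha Hb Nab; destruct (Hcov a b Ha Hb Nab) as [i Hi].
    destruct (Hl i) as (_ & _ & H & _); destruct (H a b Ha Hb Hi) as (c & Hc & Hcc).
    assert (HcW : In c (W i)) by (destruct i; simpl; [|apply in_app_iff; right]; exact Hc).
    destruct (In_nth _ _ (nil, nil) HcW) as (k & Hk & Ek).
    exists k; replace (nth k (W k) (nil, nil)) with c; [exact Hcc|].
    rewrite <- Ek; destruct (Nat.le_ge_cases i k) as [Hik|Hik].
    + symmetry; now apply Hmono.
    + apply Hmono; [exact Hik|apply Hlen].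
  - intros n; apply Rle_trans with (total_mass E (W n)).
    + rewrite (sum_eq _ (fun k => cyl_mass E (nth k (W n) (nil, nil)))).
      * apply sum_mass_nth_le; [lia|apply Hlen].
      * intros k Hk; f_equal; symmetry; apply Hmono; [exact Hk|apply Hlen].
    (* The partial sum of the geometric bounds [eps / 2^(i+1)]. *)
    + apply Rle_trans with (eps * (1 - (/ 2) ^ S n)).
      * induction n as [|n IH].
        -- destruct (Hl O) as (_ & _ & _ & H); simpl in *; lra.
        -- simpl W; rewrite total_mass_app.
           destruct (Hl (S n)) as (_ & _ & _ & H); simpl in *; lra.
      * assert (0 < (/ 2) ^ S n) by (apply pow_lt; lra); nra.
Qed.

(** * Words of fixed length and block decompositions *)

Fixpoint words (E : list nat) (L : nat) : list (list nat) :=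
  match L with
  | O => nil :: nil
  | S L => map (fun p => fst p :: snd p) (list_prod E (words E L))
  end.

Lemma length_words (E : list nat) (L : nat) : length (words E L) = (length E ^ L)%nat.
Proof.
  induction L as [|L IH]; [reflexivity|].
  simpl; rewrite length_map, length_prod, IH; reflexivity.
Qed.

Lemma in_words (E : list nat) (L : nat) (w : list nat) :
  In w (words E L) <-> length w = L /\ word_in E w.
Proof.
  revert w; induction L as [|L IH]; intros w; simpl.
  - split.
    + intros [<-|[]]; split; [reflexivity|intros e []].
    + intros [H _]; left; destruct w; [reflexivity|discriminate].
  - rewrite in_map_iff; split.
    + intros ((e & w') & <- & H); apply in_prod_iff in H; destruct H as [He Hw].
      apply IH in Hw; destruct Hw as [Hl Hw]; split; [simpl; lia|].
      intros f [<-|Hf]; [exact He|now apply Hw].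
    + destruct w as [|e w]; intros [Hl Hw]; [discriminate|].
      exists (e, w); split; [reflexivity|]; apply in_prod_iff; split.
      * apply Hw; left; reflexivity.
      * apply IH; split; [simpl in Hl; lia|intros f Hf; apply Hw; right; exact Hf].
Qed.

Lemma in_cyl_app (u w : list nat) (a : nat -> nat) :
  in_cyl u a -> in_cyl w (drop_digits (length u) a) -> in_cyl (u ++ w) a.
Proof.
  intros Hu Hw i Hi; rewrite length_app in Hi.
  destruct (Nat.lt_ge_cases i (length u)) as [H|H].
  - rewrite app_nth1 by exact H; now apply Hu.
  - rewrite app_nth2 by exact H; rewrite <- Hw by lia.
    unfold drop_digits; f_equal; lia.
Qed.

Fixpoint block_products (B : list (list nat * list nat)) (n : nat) :=
  match n with
  | O => (nil, nil) :: nil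
  | S n => map (fun p => (fst (fst p) ++ fst (snd p), snd (fst p) ++ snd (snd p)))
             (list_prod B (block_products B n))
  end.

Lemma length_block_products B n : length (block_products B n) = (length B ^ n)%nat.
Proof.
  induction n as [|n IH]; [reflexivity|].
  simpl; rewrite length_map, length_prod, IH; reflexivity.
Qed.

(* Since [N] is shift invariant, the digits of a pair in [N] avoid [(u, v)] at every
   block position; such sequences of [n] blocks have mass [(1 - m^(-2L))^n]. *)
Lemma shift_invariant_null (E : list nat) (N : (nat -> nat) -> (nat -> nat) -> Prop)
    (u v : list nat) : (1 < length E)%nat ->
  (forall a b k, N a b -> N (drop_digits k a) (drop_digits k b)) ->
  length u = length v -> word_in E u -> word_in E v ->
  (forall a b, digits_in E a -> digits_in E b -> in_cyl u a -> in_cyl v b -> ~ N a b) ->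
  finite_cover_null E N.
Proof.
  intros HE Hinv Huv Hu Hv Havoid eps He.
  set (L := length u) in *.
  set (dec := fun c c' : list nat * list nat =>
    ltac:(repeat decide equality) : {c = c'} + {c <> c'}).
  set (all := list_prod (words E L) (words E L)).
  (* The blocks that a pair in [N] may show. *)
  set (B := remove dec (u, v) all).
  assert (Hall : forall c, In c all <->
    (length (fst c) = L /\ word_in E (fst c)) /\ (length (snd c) = L /\ word_in E (snd c))).
  { intros [c1 c2]; unfold all; rewrite in_prod_iff, !in_words; reflexivity. }
  assert (HB : forall c, In c B -> In c all).
  { intros c Hc; eapply in_remove; exact Hc. }
  assert (HlB : (length B < length all)%nat).
  { apply remove_length_lt, Hall; simpl; repeat split; auto. }
  assert (Hlall : length all = (length E ^ (L + L))%nat).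
  { unfold all; rewrite length_prod, length_words, Nat.pow_add_r; reflexivity. }
  assert (Hblk : forall n c, In c (block_products B n) ->
    (length (fst c) = n * L /\ word_in E (fst c))%nat /\
    (length (snd c) = n * L /\ word_in E (snd c))%nat).
  { induction n as [|n IH]; intros c Hc.
    - destruct Hc as [<-|[]]; repeat split; intros e [].
    - simpl in Hc; apply in_map_iff in Hc; destruct Hc as ((b, w) & <- & Hc).
      apply in_prod_iff in Hc; destruct Hc as [Hb Hw].
      apply HB, Hall in Hb; apply IH in Hw; simpl; rewrite !length_app.
      destruct Hb as [[? Hb1] [? Hb2]], Hw as [[? Hw1] [? Hw2]].
      repeat split; try lia; intros e Hin; apply in_app_iff in Hin;
        destruct Hin; auto. }
  assert (Hcov : forall n a b, digits_in E a -> digits_in E b -> N a b ->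
    exists c, In c (block_products B n) /\ in_cyl_pair c a b).
  { induction n as [|n IH]; intros a b Ha Hb Nab.
    - exists (nil, nil); split; [left; reflexivity|].
      split; intros i Hi; simpl in Hi; lia.
    (* The shifted pair is again in [N], which covers the later blocks; the first block is not
       [(u, v)] by [Havoid]. *)
    - destruct (IH (drop_digits L a) (drop_digits L b)) as (w & Hw & Hwa & Hwb).
      { intros i; apply Ha. } { intros i; apply Hb. } { now apply Hinv. }
      assert (Ca : in_cyl (prefix L a) a) by now apply in_cyl_prefix.
      assert (Cb : in_cyl (prefix L b) b) by now apply in_cyl_prefix.
      exists (prefix L a ++ fst w, prefix L b ++ snd w); split.
      + simpl; apply in_map_iff; exists ((prefix L a, prefix L b), w).
        split; [reflexivity|apply in_prod_iff; split; [|exact Hw]].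
        apply in_in_remove.
        * intros Eq; injection Eq as Eu Ev; rewrite Eu in Ca; rewrite Ev in Cb.
          exact (Havoid a b Ha Hb Ca Cb Nab).
        * apply Hall; cbn [fst snd]; rewrite !length_prefix.
          repeat split; now apply word_in_prefix.
      + split; cbn [fst snd]; apply in_cyl_app; rewrite ?length_prefix; assumption. }
  assert (HmE : 0 < INR (length E)) by (apply lt_0_INR; lia).
  (* The mass of the allowed blocks, below 1 because at least one entry of [all] was removed; [n]
     blocks have mass [th ^ n]. *)
  set (th := INR (length B) * (/ INR (length E)) ^ (L + L)).
  assert (Hpow : 0 < INR (length E) ^ (L + L)) by (apply pow_lt, HmE).
  assert (Hth : 0 <= th < 1).
  { unfold th; rewrite pow_inv; split.
    - apply Rmult_le_pos; [apply pos_INR|left; apply Rinv_0_lt_compat, Hpow].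
    - apply Rmult_lt_reg_r with (INR (length E) ^ (L + L)); [exact Hpow|].
      rewrite Rmult_assoc, Rinv_l, Rmult_1_r, Rmult_1_l by lra.
      rewrite <- pow_INR, <- Hlall; apply lt_INR, HlB. }
  destruct (pow_lt_1_zero th) with (y := eps) as [n Hn]; [|exact He|].
  { rewrite Rabs_pos_eq; lra. }
  specialize (Hn n (Nat.le_refl n)).
  rewrite Rabs_pos_eq in Hn by (apply pow_le; lra).
  exists (block_products B n); split; [|split; [apply Hcov|]].
  - intros c Hc; apply Hblk in Hc; tauto.
  - rewrite (total_mass_uniform E _ ((/ INR (length E)) ^ ((L + L) * n))).
    + rewrite length_block_products, pow_INR, pow_mult, <- Rpow_mult_distr.
      left; exact Hn.
    + intros c Hc; apply Hblk in Hc; destruct Hc as [[H1 _] [H2 _]].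
      unfold cyl_mass; f_equal; nia.
Qed.

(** * Pairs that are not good *)

Lemma two_digits (E : list nat) : NoDup E -> (1 < length E)%nat ->
  exists e0 e1, In e0 E /\ In e1 E /\ (e0 < e1)%nat.
Proof.
  intros Hnd Hlen; destruct E as [|e [|f E]]; simpl in Hlen; try lia.
  inversion Hnd as [|? ? Hne _]; subst.
  destruct (Nat.lt_total e f) as [H|[->|H]].
  - exists e, f; simpl; auto.
  - exfalso; apply Hne; left; reflexivity.
  - exists f, e; simpl; auto.
Qed.

(** The expansions [e0 e0 e0 ...], [e0 e1 e1 ...] and [e1 e1 e1 ...] have three different values. A
    third point refutes density once the only rational values are 0 and 1. *)
Lemma J_third_point (d : nat) (E : list nat) (x y : R) : (2 <= d)%nat -> NoDup E ->
  (forall e, In e E -> (e < d)%nat) -> (1 < length E)%nat ->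
  exists w, inJ d E w /\ w <> x /\ w <> y.
Proof.
  intros Hd Hnd HE Hlen.
  destruct (two_digits E Hnd Hlen) as (e0 & e1 & H0 & H1 & Hlt).
  assert (HR := INR_base_ge_2 d Hd).
  assert (V0 := digit_value_const d e0 Hd (HE _ H0)).
  assert (V1 := digit_value_const d e1 Hd (HE _ H1)).
  assert (V2 := digit_value_scons d e0 _ _ Hd V1).
  apply lt_INR in Hlt.
  set (p0 := INR e0 / (INR d - 1)) in *; set (p1 := INR e1 / (INR d - 1)) in *.
  assert (E0 : p0 * (INR d - 1) = INR e0) by (unfold p0; field; lra).
  assert (E1 : p1 * (INR d - 1) = INR e1) by (unfold p1; field; lra).
  set (p2 := (INR e0 + p1) / INR d) in *.
  assert (E2 : p2 * INR d = INR e0 + p1) by (unfold p2; field; lra).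
  assert (J0 : inJ d E p0) by (exists (fun _ => e0); split; [intros i|]; assumption).
  assert (J1 : inJ d E p1) by (exists (fun _ => e1); split; [intros i|]; assumption).
  assert (J2 : inJ d E p2).
  { exists (scons e0 (fun _ => e1)); split; [intros [|i]|]; assumption. }
  assert (D01 : p0 < p1) by nra.
  assert (D02 : p0 < p2) by nra.
  assert (D21 : p2 < p1) by nra.
  destruct (Req_dec p0 x), (Req_dec p0 y), (Req_dec p1 x), (Req_dec p1 y);
    try (exists p0; repeat split; assumption);
    try (exists p1; repeat split; assumption);
    exists p2; repeat split; try assumption; lra.
Qed.

Lemma not_good_pair_related (d : nat) (E : list nat) (a b : nat -> nat) (x y : R) :
  (2 <= d)%nat -> NoDup E -> (forall e, In e E -> (e < d)%nat) -> (1 < length E)%nat ->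
  digits_in E a -> digits_in E b -> digit_value d a x -> digit_value d b y ->
  ~ good_pair d E x y ->
  exists (p : Z) (q : positive), p <> 0%Z /\ p <> Z.pos q /\
    related d E (Z.pos q - p) p (Z.pos q) a b.
Proof.
  intros Hd Hnd HE Hlen Ha Hb Hx Hy Hbad; apply NNPP; intros Hno; apply Hbad.
  assert (Jx : inJ d E x) by (exists a; auto).
  assert (Jy : inJ d E y) by (exists b; auto).
  assert (Hne : x <> y).
  (* On the diagonal the fraction -1 works, since [2 y - y = y]. *)
  { intros ->; apply Hno; exists (-1)%Z, 1%positive; repeat split; try discriminate.
    exists y, y, y, 0%Z; repeat split; auto. simpl; ring. }
  assert (Hrat : forall r z, inJ d E z -> r = faff x y z -> is_rational r ->
                   r = 0 \/ r = 1).
  { intros r z Hz Er [[p q] Eq]; apply NNPP; intros H01; apply Hno.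
    unfold Q2R in Eq; simpl in Eq.
    assert (Hq : IZR (Z.pos q) <> 0) by (apply eq_IZR_contrapositive; discriminate).
    exists p, q; repeat split.
    - intros ->; apply H01; left; rewrite Eq; ring.
    - intros ->; apply H01; right; rewrite Eq; field; exact Hq.
    - exists x, y, z, 0%Z; repeat split; auto.
      rewrite Er in Eq; unfold faff in Eq.
      assert (Ez : z = x + IZR p * / IZR (Z.pos q) * (y - x)).
      { rewrite <- Eq; field; lra. }
      rewrite minus_IZR, Ez; field; exact Hq. }
  assert (F0 : faff x y x = 0) by (unfold faff, Rdiv; ring).
  assert (F1 : faff x y y = 1) by (unfold faff; field; lra).
  split; [exact Hne|split].
  - intros r; split.
    + intros [(z & Hz & Er) Hr]; eauto.
    + intros [->| ->]; split.
      * exists x; auto.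
      * exists 0%Q; unfold Q2R; simpl; ring.
      * exists y; auto.
      * exists 1%Q; unfold Q2R; simpl; field.
  - intros Hdense.
    destruct (J_third_point d E x y Hd Hnd HE Hlen) as (w & Hw & Hwx & Hwy).
    set (s := faff x y w) in *.
    assert (Es : w = x + s * (y - x)) by (unfold s, faff; field; lra).
    assert (s0 : s <> 0) by (intros E0; apply Hwx; rewrite Es, E0; ring).
    assert (s1 : s <> 1) by (intros E1; apply Hwy; rewrite Es, E1; ring).
    assert (P0 : 0 < Rabs (0 - s)) by (apply Rabs_pos_lt; lra).
    assert (P1 : 0 < Rabs (1 - s)) by (apply Rabs_pos_lt; lra).
    (* Neither 0 nor 1 lies within this radius of [s]. *)
    destruct (Hdense w Hw (Rmin (Rabs (0 - s)) (Rabs (1 - s)))) as (z & Hz & Hr & Hc).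
    { apply Rmin_pos; assumption. }
    fold s in Hc.
    assert (C0 := Rmin_l (Rabs (0 - s)) (Rabs (1 - s))).
    assert (C1 := Rmin_r (Rabs (0 - s)) (Rabs (1 - s))).
    destruct (Hrat _ z Hz eq_refl Hr) as [Ez|Ez]; rewrite Ez in Hc; lra.
Qed.

Theorem theorem3p2 (d : nat) (E : list nat)
  (Hd : (2 <= d)%nat) (HnodupE : NoDup E)
  (HEd : forall e, In e E -> (e < d)%nat)
  (HE1 : (1 < length E)%nat) (HE2 : (length E < d)%nat) :
  pair_null E (fun a b => forall x y, digit_value d a x -> digit_value d b y ->
                            ~ good_pair d E x y).
Proof.
  destruct (two_digits E HnodupE HE1) as (e0 & e1 & H0 & H1 & Hlt).
  (* Nested Cantor pairings enumerate all fractions: one component codes the denominator minus 1,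
     the other the numerator as a difference of naturals. *)
  set (num := fun i => let (j, k) := Cantor.of_nat (snd (Cantor.of_nat i)) in
                       (Z.of_nat j - Z.of_nat k)%Z).
  set (den := fun i => Pos.of_succ_nat (fst (Cantor.of_nat i))).
  apply (pair_null_countable_union E (fun i a b =>
    num i <> 0%Z /\ num i <> Z.pos (den i) /\
    related d E (Z.pos (den i) - num i) (num i) (Z.pos (den i)) a b)).
  - exact HE1.
  - intros i.
    destruct (classic (num i <> 0%Z /\ num i <> Z.pos (den i))) as [[Hp Hq]|Hdeg].
    + destruct (exists_unrelated_cylinder d E (Z.pos (den i) - num i) (num i) (Z.pos (den i))
                  e0 e1 Hd HEd HE2 H0 H1 Hlt) as (u & v & Huv & Hu & Hv & Hav);
        [lia|exact Hp|discriminate|].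
      apply (shift_invariant_null E _ u v HE1); auto.
      * intros a b k (_ & _ & H); repeat split; auto; now apply related_drop.
      * intros a b Ha Hb Ca Cb (_ & _ & H); exact (Hav a b Ha Hb Ca Cb H).
    (* The fractions 0 and 1 contribute the empty set. *)
    + intros eps He; exists nil; repeat split.
      * destruct H.
      * destruct H.
      * intros a b _ _ (Hp & Hq & _); exfalso; auto.
      * simpl; lra.
  - intros a b Ha Hb Hbad.
    destruct (digit_value_exists d a Hd (fun i => HEd _ (Ha i))) as [x Hx].
    destruct (digit_value_exists d b Hd (fun i => HEd _ (Hb i))) as [y Hy].
    destruct (not_good_pair_related d E a b x y Hd HnodupE HEd HE1 Ha Hb Hx Hy
                (Hbad x y Hx Hy)) as (p & q & Hpq).
    (* The numerator is coded by its positive and negative parts. *)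
    exists (Cantor.to_nat (Nat.pred (Pos.to_nat q),
              Cantor.to_nat (Z.to_nat p, Z.to_nat (- p)))).
    assert (En : num (Cantor.to_nat (Nat.pred (Pos.to_nat q),
                   Cantor.to_nat (Z.to_nat p, Z.to_nat (- p)))) = p).
    { unfold num; rewrite Cantor.cancel_of_to; cbn [snd].
      rewrite Cantor.cancel_of_to; lia. }
    assert (Eq : den (Cantor.to_nat (Nat.pred (Pos.to_nat q),
                   Cantor.to_nat (Z.to_nat p, Z.to_nat (- p)))) = q).
    { unfold den; rewrite Cantor.cancel_of_to; cbn [fst]; lia. }
    rewrite En, Eq; exact Hpq.
Qed.
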